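(* Let $1<p<\infty$ and let $\Gamma$ be an uncountable set. Consider the following five classes of Banach spaces: (1) $\ell^{p,\infty}(\Gamma)$; (2) the spaces $E(\Pi_n)$, where $(\Pi_n)_{n=0}^\infty$ is a sequence of pairwise disjoint sets with non-decreasing cardinalities such that $|\Pi_n|<\sup_m|\Pi_m|=|\Gamma|$ for all $n\geq0$; (3) $F(\Gamma)$; (4) the spaces $\ell^{p,\infty}(\Gamma)\oplus F(\Pi)$, where $\Pi$ is a set with $\aleph_0<|\Pi|<|\Gamma|$; (5) the spaces $E(\Pi_n)\oplus F(\Pi)$, where $(\Pi_n)_{n=0}^\infty$ satisfies the condition in (2) and $\Pi$ is a set with $\aleph_0<|\Pi|<|\Gamma|$. These isomorphic classes are mutually exclusive: if $i,j\in\{1,\ldots,5\}$ and $i\neq j$, then no space of type $(i)$ is isomorphic to a space of type $(j)$.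
   Context: For a set $\Gamma$ and $w:\Gamma\to(0,\infty)$, $\ell^{p,\infty}(\Gamma,w)$ is the space of all $x:\Gamma\to\mathbb{R}$ with $\|x\|=\sup_{c>0}c\,(\mu\{|x|>c\})^{1/p}<\infty$, where $\mu(A)=\sum_{\gamma\in A}w(\gamma)$ for $A\subseteq\Gamma$. This expression is equivalent to a norm under which the space is a Banach space. $\ell^{p,\infty}(\Gamma)$ denotes the case $w\equiv1$. ''Isomorphic'' means linearly homeomorphic. $|A|$ denotes the cardinality of $A$. For a sequence $(\Gamma_n)_{n=0}^\infty$ of pairwise disjoint sets, $E(\Gamma_n)$ denotes $\ell^{p,\infty}(\bigcup_{n=0}^\infty\Gamma_n,w)$ with $w(\gamma)=2^n$ for $\gamma\in\Gamma_n$. For a set $\Gamma$, $F(\Gamma)$ denotes $\ell^{p,\infty}(\Gamma\times\mathbb{N},w)$ with $w(\gamma,n)=2^{-n}$ for $\gamma\in\Gamma$, $n\in\mathbb{N}=\{1,2,\ldots\}$. *)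

(* Defs.v *)
From HB Require Import structures.
From mathcomp Require Import all_boot all_order all_algebra.
From mathcomp Require Import all_classical all_reals all_analysis.
From mathcomp Require Import lra.
Set Implicit Arguments.
Unset Strict Implicit.
Unset Printing Implicit Defensive.
Import Order.TTheory GRing.Theory Num.Theory.
Import numFieldNormedType.Exports.
Local Open Scope classical_set_scope.
Local Open Scope ring_scope.

Section quasinorm.
Context {R : realType} (p : R) {T : choiceType} (w : T -> {posnum R}).
Implicit Types (A B : set T) (x y : T -> R).

Definition wmeas A : \bar R := \esum_(t in A) (w t)%:num%:E.

Definition superlevel x (c : R) : set T := [set t | c < `|x t|].

Definition wlp_norm x : \bar R := ereal_sup
  [set (c%:E * wmeas (superlevel x c) `^ p^-1)%E | c in [set c : R | 0 < c]].

Lemma wmeas_ge0 A : (0 <= wmeas A)%E.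
Proof. by apply: esum_ge0 => t _; rewrite lee_fin. Qed.

Lemma le_wmeas A B : A `<=` B -> (wmeas A <= wmeas B)%E.
Proof.
move=> AB; apply: le_ereal_sup => _ [F [finF FA] <-].
by exists F => //; split=> //; exact: subset_trans AB.
Qed.

Lemma wmeasU A B : (wmeas (A `|` B) <= wmeas A + wmeas B)%E.
Proof.
have w0 t : (0 <= (w t)%:num%:E :> \bar R)%E by rewrite lee_fin.
rewrite [X in (X <= _)%E]/wmeas (esumID A (A `|` B))//; apply: leeD.
  by apply: le_wmeas => t [].
by apply: le_wmeas => t [[]].
Qed.

Lemma wlp_norm_ge0 x : (0 <= wlp_norm x)%E.
Proof.
apply: (@le_trans _ _ (1%:E * wmeas (superlevel x 1) `^ p^-1)%E).
  by rewrite mul1e poweR_ge0.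
by apply: ereal_sup_ubound; exists 1 => /=.
Qed.

Lemma wlp_norm_ge x c : 0 < c ->
  (c%:E * wmeas (superlevel x c) `^ p^-1 <= wlp_norm x)%E.
Proof. by move=> c0; apply: ereal_sup_ubound; exists c. Qed.

Hypothesis p1 : 1 < p.

Let pV0 : 0 < p^-1. Proof. by rewrite invr_gt0 (lt_trans _ p1). Qed.

Lemma wlp_norm0 : wlp_norm 0 = 0%E.
Proof.
apply/eqP; rewrite eq_le wlp_norm_ge0 andbT.
apply: ge_ereal_sup => _ [c /= c0 <-].
rewrite (_ : superlevel _ _ = set0).
  by rewrite /wmeas esum_set0 poweR0r ?mule0// gt_eqF.
by apply/seteqP; split=> t //=; rewrite /superlevel/= normr0 ltNge (ltW c0).
Qed.

Lemma wlp_normZ_le a x : (wlp_norm (a \*: (x : T -> R^o)) <= `|a|%:E * wlp_norm x)%E.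
Proof.
have [->|a0] := eqVneq a 0.
  rewrite (_ : _ \*: _ = 0); first by rewrite wlp_norm0 normr0 mul0e.
  by apply/funext => t /=; rewrite scale0r.
have na0 : 0 < `|a| by rewrite normr_gt0.
apply: ge_ereal_sup => _ [c /= c0 <-].
rewrite -{1}(divfK (lt0r_neq0 na0) c) mulrC EFinM -muleA.
apply: lee_wpmul2l; first by rewrite lee_fin ltW.
rewrite (_ : superlevel _ _ = superlevel x (c / `|a|)); last first.
  by apply/seteqP; split=> t /=;
    rewrite /superlevel/= normrM ltr_pdivrMr// mulrC.
by apply: wlp_norm_ge; rewrite divr_gt0.
Qed.

Lemma wlp_normD_le x y :
  (wlp_norm (x + y)%R <= 4%:E * maxe (wlp_norm x) (wlp_norm y))%E.
Proof.
apply: ge_ereal_sup => _ [c /= c0 <-].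
have c20 : 0 < c / 2 by rewrite divr_gt0.
set m := maxe (wmeas (superlevel x (c / 2))) (wmeas (superlevel y (c / 2))).
have m0 : (0 <= m)%E by rewrite le_max wmeas_ge0.
have le2m : (wmeas (superlevel (x + y)%R c) <= 2%:E * m)%E.
  rewrite (_ : 2%:E * m = m + m)%E; last first.
    by rewrite (_ : 2 = 1 + 1)%R// EFinD ge0_muleDl// mul1e.
  apply: (@le_trans _ _ (wmeas (superlevel x (c / 2) `|`
                                superlevel y (c / 2)))).
    apply: le_wmeas => t /= ct; apply/orP; rewrite -implyNb; apply/implyP.
    rewrite -leNgt => xc; rewrite -(ltrD2l (c / 2)) -splitr.
    apply: (lt_le_trans ct); apply: (le_trans (ler_normD _ _)).
    by rewrite lerD2r.
  apply: (le_trans (wmeasU _ _)).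
  by apply: leeD; rewrite le_max lexx ?orbT.
have le2mp : (wmeas (superlevel (x + y)%R c) `^ p^-1 <= 2%:E * m `^ p^-1)%E.
  apply: (@le_trans _ _ ((2%:E * m) `^ p^-1)%E).
    apply: gt0_ler_poweR le2m; first exact: ltW.
      by rewrite in_itv/= leey wmeas_ge0.
    by rewrite in_itv/= leey mule_ge0.
  rewrite poweRM//; apply: lee_wpmul2r; first exact: poweR_ge0.
  rewrite poweR_EFin lee_fin -[leRHS]powRr1//.
  by rewrite ler_powR ?ler1n// invf_le1 ?(lt_trans _ p1)// ltW.
apply: (@le_trans _ _ (c%:E * (2%:E * m `^ p^-1))%E).
  by apply: lee_wpmul2l => //; rewrite lee_fin ltW.
rewrite (_ : c%:E * (2%:E * m `^ p^-1) = 4%:E * ((c / 2)%:E * m `^ p^-1))%E.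
  apply: lee_wpmul2l; first by rewrite lee_fin.
  rewrite le_max; apply/orP; rewrite /m /maxe; case: ifP => _.
    by right; exact: wlp_norm_ge.
  by left; exact: wlp_norm_ge.
by rewrite !muleA -!EFinM; congr (_%:E * _)%E; lra.
Qed.

End quasinorm.

(* [weak_lp_pred] and [weak_lp] do not depend on the proof [p1]; it is a
   parameter so that canonical structures can be inferred from it. *)
Definition weak_lp_pred {R : realType} {p : R} (p1 : 1 < p) {T : choiceType}
    (w : T -> {posnum R}) : {pred T -> R^o} :=
  mem [set x | (wlp_norm p w x < +oo)%E].

Record weak_lp {R : realType} {p : R} (p1 : 1 < p) {T : choiceType}
    (w : T -> {posnum R}) : Type := WeakLp {
  weak_lp_fun :> T -> R^o ;
  weak_lp_finite : weak_lp_fun \in weak_lp_pred p1 w }.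

Section weak_lp.
Context {R : realType} {p : R} (p1 : 1 < p) {T : choiceType} (w : T -> {posnum R}).

Local Notation wlp := (weak_lp p1 w).

Lemma weak_lp_submod_closed : submod_closed (weak_lp_pred p1 w).
Proof.
split; first by rewrite inE/= wlp_norm0.
move=> a x y; rewrite !inE/= => xoo yoo.
apply: (le_lt_trans (wlp_normD_le w p1 _ _)).
have axoo : (wlp_norm p w (a *: x) < +oo)%E.
  apply: (le_lt_trans (wlp_normZ_le w p1 a x)).
  by rewrite lte_mul_pinfty// ?lee_fin.
rewrite lte_mul_pinfty// ?lee_fin//.
by rewrite gt_max axoo yoo.
Qed.

HB.instance Definition _ :=
  GRing.isSubmodClosed.Build R (T -> R^o) (weak_lp_pred p1 w) weak_lp_submod_closed.

HB.instance Definition _ := [isSub for @weak_lp_fun R p p1 T w].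
HB.instance Definition _ := [Choice of wlp by <:].
HB.instance Definition _ := [SubChoice_isSubLmodule of wlp by <:].

Implicit Types x y z : wlp.

Definition weak_lp_norm x : \bar R := wlp_norm p w x.
#[local] Arguments weak_lp_norm x%_R.
Local Notation N := weak_lp_norm.

Lemma weak_lp_norm0 : N 0 = 0%E. Proof. exact: wlp_norm0. Qed.

Lemma weak_lp_norm_lty x : (N x < +oo)%E.
Proof. by have := weak_lp_finite x; rewrite inE. Qed.

Lemma weak_lp_normZ a x : (N (a *: x) <= `|a|%:E * N x)%E.
Proof. exact: wlp_normZ_le. Qed.

Lemma weak_lp_normN x : N (- x) = N x.
Proof.
have le y : (N (- y) <= N y)%E.
  by rewrite -scaleN1r (le_trans (weak_lp_normZ _ _))// normrN1 mul1e.
by apply/eqP; rewrite eq_le le -{1}(opprK x) le.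
Qed.

Lemma weak_lp_normD x y e :
  (N x < (e / 4)%:E)%E -> (N y < (e / 4)%:E)%E -> (N (x + y) < e%:E)%E.
Proof.
move=> xe ye; apply: (le_lt_trans (wlp_normD_le w p1 x y)).
rewrite (_ : e = 4 * (e / 4)); last by rewrite mulrC divfK.
by rewrite EFinM lte_pmul2l// gt_max xe ye.
Qed.

(* [N] is only a quasi-norm, but it is equivalent to a norm since [1 < p]; the
   uniform structure below is therefore that of the Banach space. *)
Definition weak_lp_entourage : set_system (wlp * wlp) :=
  [set A | exists2 e : R, 0 < e & forall x y, (N (x - y) < e%:E)%E -> A (x, y)].

Lemma weak_lp_entourage_ball (e : R) : 0 < e ->
  weak_lp_entourage [set xy | (N (xy.1 - xy.2) < e%:E)%E].
Proof. by move=> e0; exists e. Qed.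

Lemma weak_lp_entourage_filter : Filter weak_lp_entourage.
Proof.
split; first by exists 1.
- move=> A B [e e0 eA] [f f0 fB]; exists (Num.min e f) => [|x y].
    by rewrite lt_min e0.
  by rewrite EFin_min lt_min => /andP[/eA Axy /fB Bxy].
- by move=> A B AB [e e0 eA]; exists e => // x y /eA/AB.
Qed.

Lemma weak_lp_entourage_diagonal A : weak_lp_entourage A -> diagonal `<=` A.
Proof.
by move=> [e e0 eA] [x y]; rewrite /diagonal/= => <-; apply: eA; rewrite subrr weak_lp_norm0 lte_fin.
Qed.

Lemma weak_lp_entourage_inv A : weak_lp_entourage A -> weak_lp_entourage A^-1%relation.
Proof.
move=> [e e0 eA]; exists e => // x y xye; apply: eA.
by rewrite -opprB weak_lp_normN.
Qed.

Lemma weak_lp_entourage_split A : weak_lp_entourage A ->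
  exists2 B, weak_lp_entourage B & (B \; B)%relation `<=` A.
Proof.
move=> [e e0 eA].
exists [set xy | (N (xy.1 - xy.2) < (e / 4)%:E)%E].
  by apply: weak_lp_entourage_ball; rewrite divr_gt0.
move=> [x y] [z /= xz zy]; apply: eA.
by rewrite -(subrK z x) -addrA; exact: weak_lp_normD.
Qed.

HB.instance Definition _ := isUniform.Build wlp
  weak_lp_entourage_filter weak_lp_entourage_diagonal
  weak_lp_entourage_inv weak_lp_entourage_split.

Lemma weak_lp_nbhsP x (U : set wlp) :
  nbhs x U <-> exists2 e : R, 0 < e & forall y, (N (x - y) < e%:E)%E -> U y.
Proof.
split=> [[A [e e0 eA] AU]|[e e0 eU]].
  by exists e => // y /eA Axy; apply: AU; exact/xsectionP.
exists [set xy | (N (xy.1 - xy.2) < e%:E)%E]; last by move=> y /xsectionP /eU.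
exact: weak_lp_entourage_ball.
Qed.

Lemma weak_lp_add_continuous :
  continuous (fun x : wlp * wlp => x.1 + x.2).
Proof.
move=> [x y] U /= /weak_lp_nbhsP[e e0 eU].
have e40 : 0 < e / 4 by rewrite divr_gt0.
exists ([set z | (N (x - z) < (e / 4)%:E)%E], [set z | (N (y - z) < (e / 4)%:E)%E]).
  by split; apply/weak_lp_nbhsP; exists (e / 4).
move=> [x' y'] /= [xx' yy']; apply: eU.
by rewrite opprD addrACA; exact: weak_lp_normD.
Qed.

Lemma weak_lp_scale_continuous :
  continuous (fun z : R^o * wlp => z.1 *: z.2).
Proof.
move=> [a x] U /= /weak_lp_nbhsP[e e0 eU].
have e40 : 0 < e / 4 by rewrite divr_gt0.
have Nx : N x \is a fin_num.
  by rewrite ge0_fin_numE ?weak_lp_norm_lty//; exact: wlp_norm_ge0.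
set M := fine (N x) + 1.
have M0 : 0 < M by rewrite ltr_pwDr// fine_ge0//; exact: wlp_norm_ge0.
have NM : (N x < M%:E)%E by rewrite -(fineK Nx) lte_fin ltrDl.
set d := e / 4 / M; set f := e / 4 / (`|a| + d).
have d0 : 0 < d by rewrite divr_gt0.
have f0 : 0 < f by rewrite divr_gt0// ltr_wpDl.
exists ([set b : R^o | `|a - b| < d], [set z | (N (x - z) < f%:E)%E]).
  split; last by apply/weak_lp_nbhsP; exists f.
  by apply/nbhs_ballP; exists d.
move=> [b z] /= [ab xz]; apply: eU.
rewrite (_ : a *: x - b *: z = (a - b) *: x + b *: (x - z)); last first.
  by rewrite scalerBl scalerBr addrA subrK.
have lem (c g h k : R) (y : wlp) : 0 < g -> `|c| <= g -> (N y < h%:E)%E ->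
    g * h = k -> (N (c *: y) < k%:E)%E.
  move=> g0 cg yh <-; apply: (le_lt_trans (weak_lp_normZ _ _)).
  apply: (@le_lt_trans _ _ (g%:E * N y)%E); last by rewrite EFinM lte_pmul2l.
  by apply: lee_wpmul2r; [exact: wlp_norm_ge0|rewrite lee_fin].
apply: weak_lp_normD.
  by apply: lem NM _; [exact: d0|exact: ltW|rewrite divfK// gt_eqF].
have ad0 : 0 < `|a| + d by rewrite ltr_wpDl.
apply: (lem _ (`|a| + d)) xz _ => //.
  rewrite -{1}(subrK a b) addrC (le_trans (ler_normD _ _))// lerD2l.
  by rewrite distrC ltW.
by rewrite mulrC divfK// gt_eqF.
Qed.

HB.instance Definition _ :=
  PreTopologicalNmodule_isTopologicalNmodule.Build wlp weak_lp_add_continuous.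
HB.instance Definition _ :=
  TopologicalNmodule_isTopologicalLmodule.Build R wlp weak_lp_scale_continuous.

End weak_lp.

(* The library's product instance of [topologicalLmodType] covers only locally
   convex spaces, hence the alias. *)
Definition direct_sum {R : numFieldType} (X Y : topologicalLmodType R) : Type :=
  (X * Y)%type.

Section direct_sum.
Context {R : numFieldType} (X Y : topologicalLmodType R).
Local Notation XY := (direct_sum X Y).

HB.instance Definition _ := Topological.copy XY (X * Y)%type.
HB.instance Definition _ := GRing.Lmodule.copy XY (X * Y)%type.

Lemma direct_sum_add_continuous : continuous (fun x : XY * XY => x.1 + x.2).
Proof.
move=> [/= x y] U /= [] [A B] /= [nA nB] nU.
have [/= A0 [A01 A02] nA1] := @add_continuous X (x.1, y.1) _ nA.
have [/= B0 [B01 B02] nB1] := @add_continuous Y (x.2, y.2) _ nB.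
exists ([set z | A0.1 z.1 /\ B0.1 z.2], [set z | A0.2 z.1 /\ B0.2 z.2]).
  by split; [exists (A0.1, B0.1)|exists (A0.2, B0.2)].
move=> [[x1 y1][x2 y2]] /= [] [] a1 b1 [] a2 b2.
by apply: nU; split; [exact: (nA1 (x1, x2))|exact: (nB1 (y1, y2))].
Qed.

Lemma direct_sum_scale_continuous : continuous (fun z : R^o * XY => z.1 *: z.2).
Proof.
move=> [/= r [x y]] U /= [] /= [A B] /= [nA nB] nU.
have [/= A0 [A01 A02] nA1] := @scale_continuous R X (r, x) _ nA.
have [/= B0 [B01 B02] nB1] := @scale_continuous R Y (r, y) _ nB.
exists (A0.1 `&` B0.1, A0.2 `*` B0.2).
  by split; [exact: filterI|exists (A0.2, B0.2)].
by move=> [l [e f]] /= [] [Al Bl] [] Ae Be; apply: nU; split;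
  [exact: (nA1 (l, e))|exact: (nB1 (l, f))].
Qed.

HB.instance Definition _ :=
  PreTopologicalNmodule_isTopologicalNmodule.Build XY direct_sum_add_continuous.
HB.instance Definition _ :=
  TopologicalNmodule_isTopologicalLmodule.Build R XY direct_sum_scale_continuous.

End direct_sum.

Definition isomorphic {R : numFieldType} (X Y : topologicalLmodType R) : Prop :=
  exists (f : {linear X -> Y}) (g : Y -> X),
    [/\ cancel f g, cancel g f, continuous f & continuous g].

Section spaces.
Context {R : realType} {p : R} (p1 : 1 < p).

Definition ell_space (G : choiceType) : topologicalLmodType R :=
  weak_lp p1 (fun _ : G => 1%:pos).

(* When the [Pi n] are pairwise disjoint, the [xget] is the unique [n] with
   [Pi n t]. *)
Definition E_weight {U : choiceType} (Pi : nat -> set U)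
    (t : \bigcup_n Pi n) : {posnum R} :=
  (2 ^+ xget 0%N [set n | Pi n (val t)])%:pos.

Definition E_space {U : choiceType} (Pi : nat -> set U) : topologicalLmodType R :=
  weak_lp p1 (@E_weight U Pi).

(* The index [n : nat] stands for the positive integer [n.+1]. *)
Definition F_space (G : choiceType) : topologicalLmodType R :=
  weak_lp p1 (fun t : G * nat => (2 ^- t.2.+1)%:pos).

End spaces.

Local Open Scope card_scope.

Definition card_lt {T U : Type} (A : set T) (B : set U) : Prop :=
  A #<= B /\ ~ (B #<= A).

Definition is_card_sup {T U : Type} (Pi : nat -> set T) (A : set U) : Prop :=
  (forall n, Pi n #<= A) /\
  (forall (V : Type) (B : set V), (forall n, Pi n #<= B) -> A #<= B).

Definition admissible {U : Type} (G : Type) (Pi : nat -> set U) : Prop :=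
  [/\ trivIset setT Pi,
      forall m n, (m <= n)%N -> Pi m #<= Pi n,
      is_card_sup Pi [set: G] &
      forall n, card_lt (Pi n) [set: G]].

Definition intermediate (P G : Type) : Prop :=
  card_lt [set: nat] [set: P] /\ card_lt [set: P] [set: G].

Inductive space_of_type {R : realType} (p : R) (p1 : 1 < p) (G : choiceType) :
    nat -> topologicalLmodType R -> Prop :=
| Type1 : space_of_type p1 G 1 (ell_space p1 G)
| Type2 (U : choiceType) (Pi : nat -> set U) :
    admissible G Pi -> space_of_type p1 G 2 (E_space p1 Pi)
| Type3 : space_of_type p1 G 3 (F_space p1 G)
| Type4 (P : choiceType) :
    intermediate P G ->
    space_of_type p1 G 4 (direct_sum (ell_space p1 G) (F_space p1 P))
| Type5 (U : choiceType) (Pi : nat -> set U) (P : choiceType) :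
    admissible G Pi -> intermediate P G ->
    space_of_type p1 G 5 (direct_sum (E_space p1 Pi) (F_space p1 P)).

(* Main.v *)
From HB Require Import structures.
Require Import Defs.
From mathcomp Require Import all_boot all_order all_algebra.
From mathcomp Require Import all_classical all_reals all_analysis.
From mathcomp Require Import ring lra.
Set Implicit Arguments.
Unset Strict Implicit.
Unset Printing Implicit Defensive.
Import Order.TTheory GRing.Theory Num.Theory.
Import numFieldNormedType.Exports.
Local Open Scope classical_set_scope.
Local Open Scope ring_scope.

(** The five classes are told apart by embeddings: every case reduces to one of
    two non-embedding results, for a source space X and a target space of the
    form Z (+) F(P), where P may be empty.

    - If Q is uncountable and of larger cardinality than P, then F(Q) does not
      embed into Z (+) F(P) when all atoms of Z have weight at least 1
      ([F_not_embeds]). Both ell(G) and E(Pi) are such spaces Z. This separates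
      types 1 and 2, which contain no such F(Q), from types 3, 4 and 5, which do; and
      it separates type 3 from types 4 and 5.
    - If P and all the Pi n have smaller cardinality than the uncountable set G,
      then ell(G) does not embed into E(Pi) (+) F(P) ([ell_not_embeds]). This
      separates type 1 from type 2 and type 4 from type 5.

    Both follow from [no_embeds_direct_sum], whose proof goes as follows. Let T
    be the embedding and let e_a be the unit vectors of X.

    - A coordinate t of the target is nonzero on T e_a for only countably many
      atoms a of a given weight ([countable_image_neq0]): n such atoms, with
      suitable signs, have a sum of quasi-norm of order n^(1/p) and an image of size of
      order n at t, and p > 1. Hence a set of coordinates of smaller cardinality
      than a set A of atoms affects only few atoms of A ([smaller_bigcup]). So
      the summand F(P), and all coordinates of weight below a prescribed level,
      vanish on T e_a for uncountably many a.
    - In both situations this gives, for each M, uncountably many atoms a of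
      equal weight om such that T e_a lives on atoms of weight at least M om.
      Since T is bounded above and below, T e_a exceeds some level c on a set of
      measure of order om / c^p, and M large forces c to be small; c may be taken
      rational, hence common to uncountably many a ([unit_image_level]).
    - Such common levels c_0 > c_1 > ... cannot tend to 0
      ([no_vanishing_common_levels]). Give about c_k^p / (s^p om_k) atoms of the
      k-th family, for k < K, the coefficient s / c_k, choosing them so that
      their images are disjoint. As the coefficients grow geometrically in k, the
      resulting vector has quasi-norm at most 4^(1/p). But each of the K families
      makes its image exceed the single level s on a set of measure of order
      s^-p, so the quasi-norm of the image is at least of order K^(1/p). *)

(** * Sets of smaller cardinality *)

Section cardinality.
Local Open Scope card_scope.

(** Describing injections by relations avoids separate treatment of an empty
    codomain, on which no function need exist. *)
Lemma card_le_relP {T U} (A : set T) (B : set U) : A #<= B <->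
  exists2 r : T -> U -> Prop, (forall x, A x -> exists2 y, B y & r x y) &
    forall x x' y, A x -> A x' -> r x y -> r x' y -> x = x'.
Proof.
elim/Ppointed: U => U in B *.
  split=> [|[r rAB _]].
    by rewrite card_le_emptyr => /eqP ->; exists (fun _ _ => False).
  rewrite (_ : A = set0) ?card_ge0//; apply/seteqP; split=> // x /rAB[y].
  by rewrite emptyE.
split=> [/pcard_leP[f]|[r rAB rI]].
  exists (fun x y => y = f x) => [x Ax|x x' y Ax Ax' -> ff'].
    by exists (f x) => //; exact: funS.
  by apply: (@inj _ _ _ f); rewrite ?inE.
have /choice[f fP] : forall x, exists y, A x -> B y /\ r x y.
  move=> x; have [/rAB[y By rxy]|Ax] := pselect (A x); first by exists y.
  by exists point.
apply/pcard_leP/injfunPex; exists f => [x /fP[]//|x x'].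
rewrite !inE => Ax Ax' ff'; have [_ rx] := fP _ Ax; have [_ rx'] := fP _ Ax'.
by apply: rI rx _ => //; rewrite ff'.
Qed.

(** A maximal partial injection from [A] to [B] exhausts one of the two sets. *)
Lemma card_le_total {T U} (A : set T) (B : set U) : A #<= B \/ B #<= A.
Proof.
pose P (M : set (T * U)) := [/\ forall z, M z -> A z.1 /\ B z.2,
  forall z z', M z -> M z' -> z.1 = z'.1 -> z = z' &
  forall z z', M z -> M z' -> z.2 = z'.2 -> z = z'].
have [F FP Ftot|M [[MAB M1 M2] Mmax]] := @Zorn_bigcup _ P.
  have common z z' : (\bigcup_(X in F) X) z -> (\bigcup_(X in F) X) z' ->
      exists X, [/\ F X, X z & X z'].
    move=> [X FX Xz] [Y FY Yz'].
    by have [XY|YX] := Ftot _ _ FX FY; [exists Y|exists X]; split=> //;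
      [exact: XY|exact: YX].
  split=> [z [X /FP[XAB _ _] /XAB//]|z z' Fz Fz'|z z' Fz Fz'].
    by have [X [/FP[_ X1 _] Xz Xz']] := common _ _ Fz Fz'; exact: X1.
  by have [X [/FP[_ _ X2] Xz Xz']] := common _ _ Fz Fz'; exact: X2.
have [AM|/existsNP[x /not_implyP[Ax nx]]] :=
    pselect (forall x, A x -> exists y, M (x, y)).
  left; apply/card_le_relP; exists (fun x y => M (x, y)).
    by move=> x /AM[y xy]; exists y => //; have [] := MAB _ xy.
  by move=> x x' y _ _ xy x'y; have [] := M2 _ _ xy x'y erefl.
right; apply/card_le_relP; exists (fun y x => M (x, y)); last first.
  by move=> y y' z _ _ zy zy'; have [] := M1 _ _ zy zy' erefl.
move=> y By; apply: contrapT => ny; apply: (Mmax (M `|` [set (x, y)])).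
  split=> [z Mz|Mxy]; first by left.
  by apply: nx; exists y; apply: Mxy; right.
have {}ny x' : ~ M (x', y).
  by move=> x'y; apply: ny; exists x' => //; have [] := MAB _ x'y.
have {}nx y' : ~ M (x, y') by move=> xy'; apply: nx; exists y'.
split=> [z [/MAB//|->//]|[a b] [a' b']|[a b] [a' b']];
  move=> [Mz|[-> ->]] [Mz'|[-> ->]] //= ab; first exact: M1.
- by case: (nx b); rewrite -ab.
- by case: (nx b'); rewrite ab.
- exact: M2.
- by case: (ny a); rewrite -ab.
- by case: (ny a'); rewrite ab.
Qed.

(** By Zorn's lemma, [D] is the union of a maximal family [M] of disjoint
    injective sequences and of a finite set, which is absorbed by one of the
    sequences. A countable set thereby attached to each sequence [s] stays
    countable when multiplied by [nat], so it can be injected back into the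
    range of [s]. *)
Lemma card_setX_nat_le {T} (D : set T) : infinite_set D ->
  D `*` [set: nat] #<= D.
Proof.
move=> Doo.
pose P (M : set (nat -> T)) := [/\ forall s, M s -> forall n, D (s n),
  forall s, M s -> injective s &
  forall s s' n n', M s -> M s' -> s n = s' n' -> s = s'].
have [F FP Ftot|M [[MD Minj Mdisj] Mmax]] := @Zorn_bigcup _ P.
  split=> [s [X /FP[XD _ _] Xs]|s [X /FP[_ XI _] Xs]|]; [exact: XD|exact: XI|].
  move=> s s' n n' [X FX Xs] [Y FY Ys'].
  have [XY|YX] := Ftot _ _ FX FY.
    by have [_ _] := FP _ FY; apply => //; exact: XY.
  by have [_ _] := FP _ FX; apply => //; exact: YX.
pose F := D `\` [set x | exists2 s, M s & exists n, s n = x].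
have finF : finite_set F.
  apply: contrapT => /infiniteP/card_le_relP[r rF rI].
  have /choice[s sP] : forall n, exists x, F x /\ r n x.
    by move=> n; have [x] := rF n Logic.I; exists x.
  have sI : injective s.
    move=> m n smn; have [_ rm] := sP m; have [_ rn] := sP n.
    by apply: rI rm _ => //; rewrite smn.
  have sM s' n n' : M s' -> s n <> s' n'.
    by move=> Ms' ss'; have [[_ nx] _] := sP n; apply: nx; exists s' => //; exists n'.
  apply: (Mmax (M `|` [set s])).
    split=> [t Mt|Ms]; first by left.
    by apply: (sM s 0%N 0%N) => //; apply: Ms; right.
  split=> [t [Mt n|-> n]|t [Mt|->//]|t t' n n'].
  - exact: MD.
  - by have [[]] := sP n.
  - exact: Minj.
  move=> [Mt|->] [Mt'|->] tt' //; first exact: Mdisj tt'.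
    by case: (sM t n' n).
  by case: (sM t' n n').
have [s0 Ms0] : M !=set0.
  apply: contrapT => /set0P/negP; rewrite negbK => /eqP M0; apply: Doo.
  by rewrite (_ : D = F)// /F M0 (_ : [set _ | _] = set0) ?setD0//;
    apply/seteqP; split=> // x [].
(* The finite remainder [F] is attached to the sequence [s0]. *)
pose C s := range s `|` [set x | s = s0 /\ F x].
have /choice[c cI] : forall s, exists c : T * nat -> nat,
    {in C s `*` [set: nat] &, injective c}.
  move=> s; apply/countable_injP; apply: countableX => //.
  rewrite (_ : C s = \bigcup_(i in [set: bool])
      if i then range s else [set x | s = s0 /\ F x]); last first.
    apply/seteqP; split=> x.
      by case=> Cx; [exists true|exists false].
    by case=> -[] _ Cx; [left|right].
  apply: bigcup_countable => // -[] _.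
    by apply: (sub_countable (card_image_le _ _)).
  by apply: finite_set_countable; apply: sub_finite_set finF => x [].
apply/card_le_relP.
exists (fun xn y => exists s, [/\ M s, C s xn.1 & y = s (c s xn)]).
  move=> [x n] [/= Dx _].
  suff [s [Ms Csx]] : exists s, M s /\ C s x.
    by exists (s (c s (x, n))); [exact: MD|exists s].
  have [[s Ms [m smx]]|Fx] := pselect (exists2 s, M s & exists n, s n = x).
    by exists s; split=> //; left; exists m.
  by exists s0; split=> //; right.
move=> z z' _ _ _ [s [Ms Cs ->]] [s' [Ms' Cs' ss']].
have ? := Mdisj _ _ _ _ Ms Ms' ss'; subst s'.
by apply: cI (Minj _ Ms _ _ ss'); rewrite inE.
Qed.

Lemma card_bigcup_countable_le {I T} (D : set I) (F : I -> set T) :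
  infinite_set D -> (forall i, D i -> countable (F i)) ->
  \bigcup_(i in D) F i #<= D.
Proof.
move=> Doo cF; apply: card_le_trans (card_setX_nat_le Doo).
have /choice[c cI] : forall i, exists c : T -> nat,
    D i -> {in F i &, injective c}.
  move=> i; have [/cF/countable_injP[c cP]|nDi] := pselect (D i).
    by exists c.
  by exists (fun=> 0%N).
apply/card_le_relP.
exists (fun x z => [/\ D z.1, F z.1 x & z.2 = c z.1 x]).
  by move=> x [i Di Fix]; exists (i, c i x).
move=> x x' [i n] _ _ /= [Di Fx ->] [_ Fx' cxx'].
by apply: (cI i Di); rewrite ?inE.
Qed.

(** The sets smaller than an uncountable set [B] form an ideal that contains the
    countable sets and is closed under unions of countable sets indexed by a
    smaller set; this is the only cardinal arithmetic used below. *)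
Definition smaller {T U} (A : set T) (B : set U) := ~ (B #<= A).

Lemma smaller_countable {T U} (A : set T) (B : set U) :
  countable A -> ~ countable B -> smaller A B.
Proof. by move=> cA ncB BA; apply: ncB; exact: card_le_trans BA cA. Qed.

Lemma smaller_le {T U V} (A : set T) (A' : set U) (B : set V) :
  A #<= A' -> smaller A' B -> smaller A B.
Proof. by move=> AA' A'B BA; apply: A'B; exact: card_le_trans BA AA'. Qed.

Lemma smaller_bigcup {I T U} (D : set I) (F : I -> set T) (B : set U) :
  ~ countable B -> smaller D B -> (forall i, D i -> countable (F i)) ->
  smaller (\bigcup_(i in D) F i) B.
Proof.
move=> ncB DB cF; have [Dfin|Doo] := pselect (finite_set D).
  apply: smaller_countable => //; apply: bigcup_countable => //.
  exact: finite_set_countable.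
exact: smaller_le (card_bigcup_countable_le Doo cF) DB.
Qed.

(** The union is indexed by the larger of the two sets, each index carrying at
    most two points. *)
Lemma smallerU {T U} (A A' : set T) (B : set U) : ~ countable B ->
  smaller A B -> smaller A' B -> smaller (A `|` A') B.
Proof.
move=> ncB; wlog AA' : A A' / A #<= A' => [wl|].
  have [AA'|A'A] := card_le_total A A' => AB A'B; first exact: wl.
  by rewrite setUC; exact: wl.
move=> _ A'B; have [r rA rI] := (card_le_relP _ _).1 AA'.
have : smaller (\bigcup_(y in A') ([set y] `|` [set x | A x /\ r x y])) B.
  apply: smaller_bigcup => // y _.
  apply: finite_set_countable; rewrite finite_setU; split=> //.
  have [[x [Ax rx]]|] := pselect (exists x, A x /\ r x y).
    apply: (sub_finite_set _ (finite_set1 x)) => x' [Ax' rx'].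
    exact: rI rx' rx.
  move=> nx; apply: (sub_finite_set _ (@finite_set0 T)) => x rx.
  by case: nx; exists x.
apply: smaller_le; apply: subset_card_le => x [Ax|A'x]; last first.
  by exists x => //; left.
by have [y A'y rxy] := rA _ Ax; exists y => //; right.
Qed.

Lemma smaller_setD_uncountable {T} (A B : set T) :
  ~ countable B -> smaller A B -> ~ countable (B `\` A).
Proof.
move=> ncB AB cBA; have := smallerU ncB AB (smaller_countable cBA ncB).
by apply; apply: subset_card_le => x Bx; have [|] := pselect (A x); [left|right].
Qed.

End cardinality.

(** * Weighted counting measure and the weak-type form of the quasi-norm *)

Lemma infinite_set_seq {T : choiceType} (A : set T) (n : nat) :
  infinite_set A ->
  exists s : seq T, [/\ uniq s, forall t, t \in s -> A t & (n <= size s)%N].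
Proof.
move=> Aoo; have [B BA nB] := infinite_set_fset n Aoo.
by exists (finmap.enum_fset B); split=> //; exact: finmap.fset_uniq.
Qed.

Section weighted_counting.
Context {R : realType} {T : choiceType} (w : T -> {posnum R}).

Lemma wmeas1 t : wmeas w [set t] = (w t)%:num%:E.
Proof. by rewrite /wmeas esum_set1// lee_fin. Qed.

Lemma wmeas_ge A t : A t -> ((w t)%:num%:E <= wmeas w A)%E.
Proof. by move=> At; rewrite -wmeas1; apply: le_wmeas => _ ->. Qed.

Lemma wmeas_disjointU A B : A `&` B = set0 ->
  wmeas w (A `|` B) = (wmeas w A + wmeas w B)%E.
Proof.
move=> AB; have w0 t : (0 <= (w t)%:num%:E :> \bar R)%E by rewrite lee_fin.
rewrite [LHS]/wmeas (esumID A)// setUK; congr (_ + _)%E.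
congr (wmeas w _); apply/seteqP; split=> [t [[//|//]]|t Bt].
split; [by right|move=> At].
by have : (A `&` B) t by []; rewrite AB.
Qed.

Lemma wmeas_le_sum (I : eqType) (s : seq I) (P : pred I) (a : I -> T) A :
  (forall t, A t -> exists i, [/\ i \in s, P i & a i = t]) ->
  (wmeas w A <= (\sum_(i <- s | P i) (w (a i))%:num)%:E)%E.
Proof.
elim: s A => [|i s IH] A As.
  rewrite big_nil (_ : A = set0) ?/wmeas ?esum_set0//.
  by apply/seteqP; split=> // t /As[j []].
pose B := [set t | exists j, [/\ j \in s, P j & a j = t]].
have sB : (wmeas w B <= (\sum_(i <- s | P i) (w (a i))%:num)%:E)%E by exact: IH.
rewrite big_cons; case: ifPn => Pi.
  rewrite EFinD; apply: le_trans (leeD (lexx _) sB).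
  rewrite -wmeas1; apply: le_trans (wmeasU _ _ _); apply: le_wmeas => t /As[j [+ Pj <-]].
  rewrite inE => /orP[/eqP ji|js]; first by rewrite ji; left.
  by right; exists j.
apply: le_trans sB; apply: le_wmeas => t /As[j [+ Pj <-]].
rewrite inE => /orP[/eqP ji|js]; first by rewrite -ji Pj in Pi.
by exists j.
Qed.

Lemma sum_wmeas_le (I : eqType) (s : seq I) (B : I -> set T) A :
  uniq s -> (forall i, i \in s -> B i `<=` A) ->
  (forall i j, i \in s -> j \in s -> i != j -> B i `&` B j = set0) ->
  (\sum_(i <- s) wmeas w (B i) <= wmeas w A)%E.
Proof.
elim: s A => [|i s IH] A; first by rewrite big_nil wmeas_ge0.
move=> /= /andP[nis us] BA Bdisj; rewrite big_cons.
have BiA : B i `<=` A by apply: BA; rewrite mem_head.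
rewrite -(setDUK BiA) wmeas_disjointU ?setDIK//.
apply: leeD => //; apply: IH => // [j js t Bjt|j k js ks].
  split; first by apply: (BA j) => //; rewrite inE js orbT.
  have : i != j by apply: contraNneq nis => ->.
  move=> /Bdisj Bij0 Bit; have : (B i `&` B j) t by [].
  by rewrite Bij0 ?mem_head// inE js orbT.
by apply: Bdisj; rewrite inE ?js ?ks orbT.
Qed.

Lemma wmeas_infinite A (v : R) : 0 < v -> infinite_set A ->
  (forall t, A t -> v <= (w t)%:num) -> wmeas w A = +oo%E.
Proof.
move=> v0 Aoo vA.
suff ge (r : R) : 0 < r -> (r%:E <= wmeas w A)%E by apply/eqyP; exact: ge.
move=> r0.
have [B [uB BA nB]] := infinite_set_seq (Num.bound (r / v)) Aoo.
apply: (@le_trans _ _ (\sum_(t <- B) wmeas w [set t])%E).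
  apply: (@le_trans _ _ ((v *+ (size B))%:E)).
    rewrite lee_fin -mulr_natr -ler_pdivrMl// mulrC.
    have /archi_boundP/ltW/le_trans : 0 <= r / v by rewrite divr_ge0// ltW.
    by apply; rewrite ler_nat.
  rewrite (eq_bigr _ (fun t _ => wmeas1 t)) sumEFin lee_fin big_seq.
  rewrite -sum1_size -mulr_natr natr_sum mulr_sumr big_seq ler_sum// => t tB.
  by rewrite mulr1 vA//; exact: BA.
apply: sum_wmeas_le => // [t tB _ ->|t t' _ _ tt']; first exact: BA.
by apply/seteqP; split=> // _ [-> tt]; rewrite tt eqxx in tt'.
Qed.

(** All weights are positive, so a set of finite measure has finitely many atoms
    of weight at least [n.+1^-1] for each [n]. *)
Lemma wmeas_lty_countable A : (wmeas w A < +oo)%E -> countable A.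
Proof.
move=> Aoo.
rewrite (_ : A = \bigcup_n (A `&` [set t | n.+1%:R^-1 <= (w t)%:num])).
  apply: bigcup_countable => // n _; apply: finite_set_countable.
  apply: contrapT => /(@wmeas_infinite _ n.+1%:R^-1).
  rewrite invr_gt0 ltr0n => /(_ isT)/(_ (fun t => @proj2 _ _)) An.
  suff : (+oo < +oo :> \bar R)%E by rewrite ltxx.
  by rewrite -{1}An (le_lt_trans _ Aoo)//; apply: le_wmeas; exact: subIsetl.
apply/seteqP; split=> [t At|t [n _ []//]].
have [n nt] := ltr_add_invr (gt0 (w t)); exists n => //; split=> //=.
by rewrite ltW// -[ltLHS]add0r.
Qed.

End weighted_counting.

Lemma powR_inv_le {R : realType} (r a b : R) : 0 < r -> 0 <= a -> 0 <= b ->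
  (a `^ r^-1 <= b) = (a <= b `^ r).
Proof.
move=> r0 a0 b0; have rn0 : r != 0 by rewrite gt_eqF.
apply/idP/idP => [ab|ab].
  rewrite -[leLHS]powRr1// -(mulVf rn0) powRrM.
  by apply: ge0_ler_powR; rewrite ?nnegrE ?powR_ge0// ltW.
rewrite -[leRHS]powRr1// -(mulfV rn0) powRrM.
by apply: ge0_ler_powR; rewrite ?nnegrE ?powR_ge0 ?invr_ge0// ltW.
Qed.

Lemma powR_div {R : realType} (r a b : R) : 0 <= a -> 0 < b ->
  (a / b) `^ r = a `^ r / b `^ r.
Proof.
move=> a0 b0; rewrite powRM ?invr_ge0 ?(ltW b0)//; congr (_ * _).
by rewrite -[b^-1]powR_inv1 ?(ltW b0)// -powRrM mulrC powRrM powR_inv1 ?powR_ge0.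
Qed.

Lemma powRVK {R : realType} (r a : R) : 0 < r -> 0 <= a -> (a `^ r^-1) `^ r = a.
Proof. by move=> r0 a0; rewrite -powRrM mulVf ?gt_eqF// powRr1. Qed.

Section weak_norm.
Context {R : realType} {p : R} (p1 : 1 < p) {T : choiceType}.
Context (w : T -> {posnum R}).

Let p0 : 0 < p. Proof. exact: lt_trans p1. Qed.

(** This turns every estimate of the quasi-norm into weak-type bounds on the
    measures of superlevel sets, which is the form used from here on. *)
Lemma wlp_norm_leP (x : T -> R) (r : R) : 0 <= r ->
  (wlp_norm p w x <= r%:E)%E <->
  forall c, 0 < c -> (wmeas w (superlevel x c) <= ((r / c) `^ p)%:E)%E.
Proof.
move=> r0; have key c m : 0 < c -> (0 <= m)%E ->
    ((c%:E * m `^ p^-1 <= r%:E) = (m <= ((r / c) `^ p)%:E))%E.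
  move=> c0; case: m => [m||//] m0; last first.
    by rewrite poweRyr ?invr_eq0 ?gt_eqF// gt0_muley ?lte_fin// !leye_eq.
  rewrite poweR_EFin -EFinM !lee_fin mulrC -ler_pdivlMr//.
  by apply: powR_inv_le => //; rewrite divr_ge0// ltW.
split=> [xr c c0|xr].
  by rewrite -key ?wmeas_ge0// (le_trans _ xr)// wlp_norm_ge.
by apply: ge_ereal_sup => _ [c /= c0 <-]; rewrite key ?wmeas_ge0 ?xr.
Qed.

End weak_norm.

(** * Unit vectors and their finite combinations *)

Section unit_vectors.
Context {R : realType} {p : R} (p1 : 1 < p) {T : choiceType}.
Context (w : T -> {posnum R}).
Local Notation wlp := (weak_lp p1 w).

Let p0 : 0 < p. Proof. exact: lt_trans p1. Qed.

Lemma superlevel_unit (a : T) (c : R) : 0 < c ->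
  superlevel (fun t => (t == a)%:R : R) c = if c < 1 then [set a] else set0.
Proof.
move=> c0; apply/seteqP; split=> t; rewrite /superlevel/=; last first.
  by case: ltP => // c1 ->; rewrite eqxx normr1.
have [->|_] := eqVneq t a; last by rewrite normr0 ltNge (ltW c0).
by rewrite normr1 => ->.
Qed.

Lemma wlp_norm_unit (a : T) :
  (wlp_norm p w (fun t => (t == a)%:R : R) <= ((w a)%:num `^ p^-1)%:E)%E.
Proof.
apply/(wlp_norm_leP p1); first exact: powR_ge0.
move=> c c0; rewrite superlevel_unit// powR_div ?powR_ge0// powRVK//.
case: ltP => c1; last by rewrite /wmeas esum_set0 lee_fin divr_ge0 ?powR_ge0.
rewrite wmeas1 lee_fin ler_pdivlMr ?powR_gt0// ler_piMr//.
have <- : 1 `^ p = 1 :> R by rewrite powR1.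
by apply: ge0_ler_powR; rewrite ?nnegrE ?ltW.
Qed.

Lemma wlp_unit_subproof (a : T) :
  (fun t => (t == a)%:R : R^o) \in weak_lp_pred p1 w.
Proof. by rewrite inE /=; exact: le_lt_trans (wlp_norm_unit a) (ltry _). Qed.

Definition wlp_unit (a : T) : wlp := WeakLp (wlp_unit_subproof a).

(** The unit vector at [a] has quasi-norm exactly [w a ^ (1/p)]; half of it is
    a convenient strict lower bound, witnessed by the level [3 / 4]. *)
Lemma wlp_norm_unit_gt (a : T) :
  ~ (weak_lp_norm (wlp_unit a) <= ((w a)%:num `^ p^-1 / 2)%:E)%E.
Proof.
move=> /(wlp_norm_leP p1)-/(_ _)/wrap[]; first by rewrite divr_ge0 ?powR_ge0.
have c1 : (3 / 4 : R) < 1 by lra.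
have c0 : 0 < 3 / 4 :> R by lra.
move=> /(_ _ c0); apply/negP; rewrite -ltNge superlevel_unit// c1.
rewrite wmeas1 lte_fin -mulrA powRM ?powR_ge0 ?divr_ge0//.
rewrite powRVK// gtr_pMr//.
rewrite -[ltRHS](_ : 1 `^ p = 1); last by rewrite powR1.
by apply: gt0_ltr_powR; rewrite ?nnegrE ?divr_ge0// ltr_pdivrMr//; lra.
Qed.

Lemma weak_lp_sumE (I : Type) (s : seq I) (F : I -> wlp) (t : T) :
  (\sum_(i <- s) F i) t = \sum_(i <- s) F i t.
Proof. by elim/big_ind2 : _ => // x a y b <- <-. Qed.

Lemma wmeas_superlevel_comb (I : eqType) (s : seq I) (a : I -> T) (u : I -> R)
    (c : R) : 0 < c -> uniq s -> {in s &, injective a} ->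
  (wmeas w (superlevel (\sum_(i <- s) u i *: wlp_unit (a i))%R c)
   <= (\sum_(i <- s | c < `|u i|) (w (a i))%:num)%:E)%E.
Proof.
move=> c0 us aI; apply: wmeas_le_sum => t; rewrite /superlevel/= weak_lp_sumE.
rewrite (eq_bigr (fun i => u i * (t == a i)%:R))//.
have [[i si ait]|nt] := pselect (exists2 i, i \in s & a i = t).
  rewrite (bigD1_seq i)//= big_seq_cond big1 ?addr0 => [|j /andP[js ji]].
    by rewrite ait eqxx mulr1 => ui; exists i.
  rewrite -ait; case: eqVneq => [/aI ij|]; last by rewrite mulr0.
  by rewrite ij ?eqxx in ji.
rewrite big_seq big1 ?normr0 => [/(lt_trans c0)|i si]; first by rewrite ltxx.
case: eqVneq => [ti|]; last by rewrite mulr0.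
by case: nt; exists i.
Qed.

End unit_vectors.

(** * Images of unit vectors under a bounded operator *)

Section operators.
Context {R : realType} {p : R} (p1 : 1 < p) {S T : choiceType}.
Context (v : S -> {posnum R}) (w : T -> {posnum R}).
Local Notation V := (weak_lp p1 v).
Local Notation Z := (weak_lp p1 w).

Let p0 : 0 < p. Proof. exact: lt_trans p1. Qed.

Definition bounded_by (f : V -> Z) (C : R) := forall (x : V) (r : R), 0 < r ->
  (weak_lp_norm x <= r%:E -> weak_lp_norm (f x) <= (C * r)%:E)%E.

Context (f : {linear V -> Z}) (C : R).
Hypotheses (C0 : 0 < C) (fC : bounded_by f C).

Lemma bounded_by_wmeas (x : V) (K c : R) : 0 < K ->
  (forall b, 0 < b -> (wmeas v (superlevel x b) <= (K / b `^ p)%:E)%E) ->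
  0 < c -> (wmeas w (superlevel (f x) c) <= (C `^ p * K / c `^ p)%:E)%E.
Proof.
move=> K0 xK c0.
have xK' : (weak_lp_norm x <= (K `^ p^-1)%:E)%E.
  apply/(wlp_norm_leP p1); first exact: powR_ge0.
  by move=> b b0; rewrite powR_div ?powR_ge0// powRVK ?(ltW K0)// xK.
have := fC (powR_gt0 _ K0) xK'.
move=> /(wlp_norm_leP p1)-/(_ _)/wrap[]; first by rewrite mulr_ge0 ?powR_ge0// ltW.
move=> /(_ _ c0); rewrite powR_div ?mulr_ge0 ?powR_ge0 ?(ltW C0)//.
by rewrite powRM ?powR_ge0 ?(ltW C0)// powRVK ?(ltW K0).
Qed.

(** Otherwise, for some [j], infinitely many images exceed [j.+1^-1] in absolute
    value at [t]. Summing [N] of these unit vectors with the signs of their images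
    gives a vector of measure at most [N * om / b ^ p] above each level [b], whose
    image exceeds [N / j.+1] at [t]. Boundedness then bounds [N ^ (p - 1)] by a
    constant [K], which is absurd since [1 < p]. *)
Lemma countable_image_neq0 (t : T) (om : R) :
  countable [set a | (v a)%:num = om /\ f (wlp_unit p1 v a) t != 0].
Proof.
rewrite (_ : [set _ | _] = \bigcup_n
    [set a | (v a)%:num = om /\ n.+1%:R^-1 < `|f (wlp_unit p1 v a) t|]); last first.
  apply/seteqP; split=> [a /= [va fa]|a [n _ [va fa]]].
    rewrite -normr_gt0 in fa; have [n na] := ltr_add_invr fa.
    by exists n => //; split=> //=; rewrite -[ltLHS]add0r.
  split=> //; rewrite -normr_gt0; apply: lt_trans fa.
  by rewrite invr_gt0 ltr0n.
apply: bigcup_countable => // j _; apply: finite_set_countable.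
apply: contrapT => Boo.
have om0 : 0 < om.
  have [a [va _]] := infinite_setN0 Boo; by rewrite -va gt0.
set wt := (w t)%:num; pose q := p - 1.
have wt0 : 0 < wt by rewrite /wt gt0.
have q0 : 0 < q by rewrite subr_gt0.
pose K := C `^ p * om * j.+1%:R `^ p / wt.
have K0 : 0 <= K by rewrite /K !mulr_ge0 ?powR_ge0 ?invr_ge0 ?(ltW om0) ?(ltW wt0).
have [s [us sB ns]] := infinite_set_seq (Num.bound (K `^ q^-1)) Boo.
set N : R := (size s)%:R.
have KN : K `^ q^-1 < N.
  by apply: lt_le_trans (archi_boundP (powR_ge0 _ _)) _; rewrite ler_nat.
have N0 : 0 < N by apply: le_lt_trans KN; exact: powR_ge0.
have {}KN : K < N `^ q.
  rewrite ltNge; apply/negP => NK; move: KN; apply/negP; rewrite -leNgt.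
  rewrite -[leLHS]powRr1 ?(ltW N0)// -(mulfV (lt0r_neq0 q0)) powRrM.
  by apply: ge0_ler_powR; rewrite ?nnegrE ?powR_ge0 ?invr_ge0// ltW.
pose u a := Num.sg (f (wlp_unit p1 v a) t).
pose x : V := \sum_(a <- s) u a *: wlp_unit p1 v a.
have xN b : 0 < b -> (wmeas v (superlevel x b) <= (N * om / b `^ p)%:E)%E.
  move=> b0; have idI : {in s &, injective (id : S -> S)} by move=> ? ? _ _.
  apply: (le_trans (wmeas_superlevel_comb p1 v u b0 us idI)).
  rewrite lee_fin; case: (ltP b 1) => b1; last first.
    rewrite big1 ?mulr_ge0 ?invr_ge0 ?powR_ge0 ?(ltW N0) ?(ltW om0)// => a.
    rewrite normr_sg => /(le_lt_trans b1).
    by case: eqP; rewrite ?ltr10 ?ltxx.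
  apply: (@le_trans _ _ (N * om)).
    rewrite /N -sum1_size natr_sum mulr_suml [leRHS]big_seq.
    rewrite big_mkcond big_seq ler_sum// => a /sB[-> _].
    by case: ifP; rewrite mul1r// ltW.
  rewrite ler_pdivlMr ?powR_gt0// ler_piMr ?mulr_ge0 ?ltW//.
  rewrite -[ltRHS](_ : 1 `^ p = 1); last by rewrite powR1.
  by apply: gt0_ltr_powR; rewrite ?nnegrE ?ltW.
pose c := N / j.+1%:R.
have c0 : 0 < c by rewrite divr_gt0.
have fxc : c < `|f x t|.
  rewrite /x linear_sum weak_lp_sumE.
  rewrite (eq_bigr (fun a => `|f (wlp_unit p1 v a) t|)); last first.
    by move=> a _; rewrite linearZZ normrEsg.
  rewrite ger0_norm ?sumr_ge0// /c /N -sum1_size natr_sum mulr_suml.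
  rewrite big_seq [ltRHS]big_seq; apply: ltr_sum => [|a /sB[_]]; last by rewrite mul1r.
  apply/hasP; move: N0; rewrite /N; case: (s) => [|a s' _]; first by rewrite ltxx.
  by exists a; rewrite mem_head.
have := le_trans (wmeas_ge w fxc) (bounded_by_wmeas (mulr_gt0 N0 om0) xN c0).
rewrite lee_fin -/wt; apply/negP; rewrite -ltNge.
rewrite powR_div ?ltW// -(mulr_powRB1 (ltW N0) p0) -/q.
rewrite invf_div mulrA ltr_pdivrMr ?mulr_gt0 ?powR_gt0//.
move: KN; rewrite /K ltr_pdivrMr// -(ltr_pM2l N0) => KN.
by apply: le_lt_trans (lt_le_trans KN _); rewrite le_eqVlt; apply/orP; left;
  apply/eqP; ring.
Qed.

End operators.

(** * Common levels of the images of unit vectors *)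

(** A greedy choice along an enumeration of the indices: at each stage only
    countably many elements conflict with the finitely many chosen so far. *)
Lemma pairwise_selection {T : choiceType} (A : nat * nat -> set T)
    (D : T -> T -> Prop) :
  (forall i, ~ countable (A i)) ->
  (forall i b, countable (A i `&` [set a | ~ D b a])) ->
  (forall a b, D a b -> D b a) ->
  exists2 a : nat * nat -> T, forall i, A i (a i) &
    forall i j, i != j -> D (a i) (a j).
Proof.
move=> Anc ADc Dsym; pose A' n := A (odflt (0, 0)%N (unpickle n)).
have /choice[g gP] : forall l : seq T, exists a,
    A' (size l) a /\ forall b, b \in l -> D b a.
  move=> l; apply: contrapT => nex; apply: (Anc (odflt (0, 0)%N (unpickle (size l)))).
  have : countable (\bigcup_(b in [set` l])
      (A' (size l) `&` [set a | ~ D b a])).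
    apply: bigcup_countable => [|b _]; last exact: ADc.
    exact/finite_set_countable/finite_seq.
  apply: sub_countable; apply: subset_card_le => a Aa.
  apply: contrapT => na; apply: nex; exists a; split=> // b bl.
  by apply: contrapT => nD; apply: na; exists b.
pose fix L n := if n is m.+1 then rcons (L m) (g (L m)) else [::].
have sL n : size (L n) = n by elim: n => //= n IH; rewrite size_rcons IH.
have LL m n : (m < n)%N -> g (L m) \in L n.
  elim: n => // n IH; rewrite ltnS leq_eqVlt => /orP[/eqP->|/IH mn] /=.
    by rewrite mem_rcons mem_head.
  by rewrite mem_rcons inE mn orbT.
exists (fun i => g (L (pickle i))) => [i|i j ij].
  by have [+ _] := gP (L (pickle i)); rewrite sL /A' pickleK.
have : pickle i != pickle j by apply: contra_neq ij => /(pcan_inj pickleK).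
rewrite neq_ltn => /orP[] /LL.
  by have [_ +] := gP (L (pickle j)); apply.
by have [_ +] := gP (L (pickle i)) => /[apply] /Dsym.
Qed.

(** Each term is at most [2 * (e k - e k.+1)] for [e k := min (d k) D], so that
    the sum telescopes. *)
Lemma halving_sum_le {R : realFieldType} (d : nat -> R) (D : R) (K : nat) :
  (forall k, 0 < d k) -> (forall k, d k.+1 <= d k / 2) -> 0 <= D ->
  \sum_(0 <= k < K | d k < D) d k <= 2 * D.
Proof.
move=> d0 dS D0; pose e k := Num.min (d k) D.
have e0 k : 0 <= e k by rewrite le_min D0 ltW.
apply: (@le_trans _ _ (\sum_(0 <= k < K) 2 * (e k - e k.+1))).
  rewrite big_mkcond; apply: ler_sum => k _; rewrite /e.
  have := dS k; have := d0 k; have := d0 k.+1.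
  case: (ltP (d k) D) => dD; case: (ltP (d k.+1) D) => dSD; lra.
rewrite -mulr_sumr ler_pM2l//.
have -> : \sum_(0 <= k < K) (e k - e k.+1) = e 0%N - e K.
  by rewrite -[RHS]opprB -telescope_sumr// -sumrN; apply: eq_bigr => k _; rewrite opprB.
have eD : e 0%N <= D by rewrite ge_min lexx orbT.
by have := e0 K; lra.
Qed.

Lemma exists_lower_bound {R : realFieldType} (u : nat -> R) (K : nat) :
  (forall k, 0 < u k) -> exists2 s, 0 < s & forall k, (k < K)%N -> s <= u k.
Proof.
move=> u0; elim: K => [|K [s s0 sP]]; first by exists 1.
exists (Num.min s (u K)); first by rewrite lt_min s0 u0.
move=> k; rewrite ltnS leq_eqVlt ge_min => /orP[/eqP->|/sP->//].
by rewrite lexx orbT.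
Qed.

Section scales.
Context {R : realType} {p : R} (p1 : 1 < p) {S T : choiceType}.
Context (v : S -> {posnum R}) (w : T -> {posnum R}).
Local Notation V := (weak_lp p1 v).
Local Notation Z := (weak_lp p1 w).
Local Notation e := (wlp_unit p1 v).

Let p0 : 0 < p. Proof. exact: lt_trans p1. Qed.

(** [c] is a level at which the images of the atoms [a] in [A] realise a fixed
    fraction of the weak-type bound [om / c ^ p] inherited from the unit vectors.
    Having the same level and the same weight for uncountably many atoms allows
    arbitrarily many of them to be added up with disjoint images. *)
Definition common_level (f : V -> Z) (th c om : R) (A : set S) :=
  [/\ 0 < om, ~ countable A &
      forall a, A a -> (v a)%:num = om /\
        ((th * om / c `^ p)%:E <= wmeas w (superlevel (f (e a)) c))%E].

Lemma common_level_sequence (f : V -> Z) (th : R) :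
  (forall eps, 0 < eps -> exists c om A, 0 < c <= eps /\ common_level f th c om A) ->
  exists c om A, [/\ forall k, 0 < c k, forall k, c k.+1 <= c k / 2 &
    forall k : nat, common_level f th (c k) (om k) (A k)].
Proof.
move=> H; have /choice[g gP] : forall eps, exists q : R * R * set S, 0 < eps ->
    0 < q.1.1 <= eps /\ common_level f th q.1.1 q.1.2 q.2.
  move=> eps; have [/H[c [om [A cA]]]|] := pselect (0 < eps).
    by exists (c, om, A).
  by exists (0, 0, set0).
pose q := fix q n := if n is m.+1 then g ((q m).1.1 / 2) else g 1.
have q0 n : 0 < (q n).1.1.
  elim: n => [|n IH] /=; first by have [/andP[]] := gP 1 ltr01.
  by have [/andP[]] := gP _ (divr_gt0 IH (ltr0Sn R 1)).
exists (fun k => (q k).1.1), (fun k => (q k).1.2), (fun k => (q k).2).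
split=> // [k|[|k]] /=.
- by have [/andP[]] := gP _ (divr_gt0 (q0 k) (ltr0Sn R 1)).
- by have [] := gP 1 ltr01.
- by have [] := gP _ (divr_gt0 (q0 k) (ltr0Sn R 1)).
Qed.

Context (f : {linear V -> Z}) (C : R).
Hypotheses (C0 : 0 < C) (fC : bounded_by f C).

Definition disjoint_images (a b : S) :=
  a <> b /\ forall t, f (e a) t = 0 \/ f (e b) t = 0.

Lemma countable_support (z : Z) : countable [set t | z t != 0].
Proof.
rewrite (_ : [set _ | _] = \bigcup_n superlevel z n.+1%:R^-1).
  apply: bigcup_countable => // n _; apply: (@wmeas_lty_countable _ _ w).
  have z0 := wlp_norm_ge0 p w z.
  have zoo : wlp_norm p w z \is a fin_num.
    by rewrite ge0_fin_numE//; exact: weak_lp_norm_lty.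
  apply: le_lt_trans (ltry _); apply: ((wlp_norm_leP p1 w z (fine_ge0 z0)).1).
    by rewrite fineK.
  by rewrite invr_gt0.
apply/seteqP; split=> [t /= zt|t [n _]].
  rewrite -normr_gt0 in zt; have [n nt] := ltr_add_invr zt.
  by exists n => //; rewrite /superlevel/= -[ltLHS]add0r.
by rewrite /superlevel/= -normr_gt0; apply: lt_trans; rewrite invr_gt0.
Qed.

(** The support of the image of [b] is countable, and each of its points meets the
    images of countably many atoms of weight [om]. *)
Lemma countable_not_disjoint_images (A : set S) (om : R) (b : S) :
  (forall a, A a -> (v a)%:num = om) ->
  countable (A `&` [set a | ~ disjoint_images b a]).
Proof.
move=> Aom.
have : countable ([set b] `|` \bigcup_(t in [set t | f (e b) t != 0])
    [set a | (v a)%:num = om /\ f (e a) t != 0]).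
  rewrite -bigcup2E; apply: bigcup_countable => // -[|[|//]] _ /=.
    exact: countable1.
  apply: bigcup_countable; first exact: countable_support.
  by move=> t _; exact: countable_image_neq0 C0 fC _ _.
apply: sub_countable; apply: subset_card_le => a [Aa nab].
have [ab|ab] := pselect (b = a); first by left.
right; apply: contrapT => na; apply: nab; split=> // t.
have [|bt] := eqVneq (f (e b) t) 0; first by left.
right; apply/eqP; apply: contrapT => /negP at0; apply: na; exists t => //=.
by split=> //; exact: Aom.
Qed.

(** The test vector gives the coefficient [s / c k] to [N k] atoms of the [k]-th
    family, [k < K], where [N k] is about [c k ^ p / (s ^ p * om k)]; these atoms
    have total measure about [(s / c k) ^- p], so the measures add up to a
    geometric sum and the weak-type bound of the vector does not depend on [K]. The
    image of the vector exceeds [s] wherever the image of one of the selected atoms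
    of the [k]-th family exceeds [c k]. As the images are disjoint, this happens on
    a set of measure at least [K * th / s ^ p]. *)
Lemma no_vanishing_common_levels (th : R) : 0 < th ->
  (forall eps, 0 < eps -> exists c om A, 0 < c <= eps /\ common_level f th c om A) ->
  False.
Proof.
move=> th0 /common_level_sequence[c [om [A [c0 cS prof]]]].
have om0 k : 0 < om k by have [] := prof k.
have vA k a : A k a -> (v a)%:num = om k.
  by move=> Aa; have [_ _ /(_ _ Aa)[]] := prof k.
have [a aA aD] : exists2 a : nat * nat -> S, forall i, A i.1 (a i) &
    forall i j, i != j -> disjoint_images (a i) (a j).
  apply: (@pairwise_selection _ (fun i => A i.1)) => [i|i b|b b' [bb' bt]].
  - by have [] := prof i.1.
  - by apply: countable_not_disjoint_images => a'; exact: vA.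
  - by split=> [/esym//|t]; have [] := bt t; [right|left].
have aI : injective a.
  by move=> i j aij; apply: contrapT => /eqP /aD[]; rewrite aij.
pose d k := c k `^ p.
have d0 k : 0 < d k by exact: powR_gt0.
have dS k : d k.+1 <= d k / 2.
  apply: (@le_trans _ _ ((c k / 2) `^ p)).
    by apply: ge0_ler_powR; rewrite ?nnegrE ?divr_ge0// ltW.
  rewrite powRM ?invr_ge0 ?(ltW (c0 k))// ler_wpM2l ?powR_ge0// ge1r_powR ?(ltW p1)//.
  by rewrite invr_gt0 invf_le1 ?ltr0n// ler1n.
pose K := Num.bound (4 * C `^ p / th).
have KP : 4 * C `^ p < th * K%:R.
  rewrite [ltRHS]mulrC -ltr_pdivrMr//; apply: archi_boundP.
  by rewrite divr_ge0 ?mulr_ge0 ?powR_ge0 ?ltW.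
(* [sg] is [s ^ p], small enough for each family to contribute at least one
   atom; this makes rounding [y k] up to the integer [N k] harmless. *)
have [sg sg0 sgP] : exists2 sg, 0 < sg &
    forall k, (k < K)%N -> sg <= d k / om k.
  by apply: exists_lower_bound => k; rewrite divr_gt0.
pose y k := d k / (sg * om k).
have y1 k : (k < K)%N -> 1 <= y k.
  move=> /sgP; rewrite ler_pdivlMr// => sgk.
  by rewrite /y ler_pdivlMr ?mulr_gt0// mul1r.
pose N k := (Num.truncn (y k)).+1.
have Ny k : y k <= (N k)%:R by rewrite ltW// truncnS_gt.
have N2y k : (k < K)%N -> (N k)%:R <= 2 * y k.
  move=> kK; have y1k := y1 k kK.
  have ty : (Num.truncn (y k))%:R <= y k by rewrite truncn_le (le_trans _ y1k).
  have -> : (N k)%:R = (Num.truncn (y k))%:R + 1 :> R by rewrite natr1.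
  lra.
pose idx := [seq (k, r) | k <- index_iota 0 K, r <- index_iota 0 (N k)].
have uidx : uniq idx.
  apply: allpairs_uniq_dep => [|k _|]; rewrite ?iota_uniq//.
  by move=> [k r] [k' r'] _ _ [/= -> ->].
have idxK i : i \in idx -> (i.1 < K)%N.
  by move=> /allpairsPdep[k [r [+ _ ->]]]; rewrite mem_index_iota.
have sum_idx (P : pred nat) (g : nat -> R) :
    \sum_(i <- idx | P i.1) g i.1 = \sum_(0 <= k < K | P k) (N k)%:R * g k.
  rewrite big_mkcond big_allpairs_dep [RHS]big_mkcond; apply: eq_bigr => k _ /=.
  rewrite big_const_nat subn0 iter_addr_0; case: ifP => _; last by rewrite mul0rn.
  by rewrite mulr_natl.
pose s := sg `^ p^-1.
have s0 : 0 < s by exact: powR_gt0.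
have sp : s `^ p = sg by rewrite powRVK// ltW.
pose u (i : nat * nat) := s / c i.1.
have u0 i : 0 < u i by exact: divr_gt0.
pose x : V := \sum_(i <- idx) u i *: e (a i).
have x4 b : 0 < b -> (wmeas v (superlevel x b) <= (4 / b `^ p)%:E)%E.
  move=> b0; apply: (le_trans (wmeas_superlevel_comb p1 v u b0 uidx (in2W aI))).
  rewrite lee_fin.
  under eq_bigl do rewrite gtr0_norm//.
  under eq_bigr => i _ do rewrite (vA i.1)//.
  rewrite (sum_idx (fun k => b < s / c k) om).
  pose D := sg / b `^ p; have D0 : 0 <= D by rewrite divr_ge0 ?powR_ge0// ltW.
  apply: (@le_trans _ _ (\sum_(0 <= k < K | d k < D) 2 / sg * d k)).
    rewrite big_nat_cond [leRHS]big_nat_cond.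
    rewrite big_mkcond [leRHS]big_mkcond; apply: ler_sum => k _.
    case: ifPn => [/andP[kK bk]|_]; last first.
      by case: ifP => // _; rewrite mulr_ge0 ?divr_ge0// ltW.
    rewrite kK /= ifT; last first.
      rewrite /d /D -sp -powR_div ?(ltW s0)//; apply: gt0_ltr_powR => //.
      - by rewrite nnegrE ltW.
      - by rewrite nnegrE divr_ge0// ltW.
      - by rewrite ltr_pdivlMr// mulrC -ltr_pdivlMr.
    have kK' : (k < K)%N by [].
    apply: le_trans (ler_wpM2r (ltW (om0 k)) (N2y _ kK')) _.
    rewrite /y invfM le_eqVlt; apply/orP; left; apply/eqP.
    by field; rewrite !gt_eqF.
  rewrite -mulr_sumr; apply: le_trans (ler_wpM2l _ (halving_sum_le K d0 dS D0)) _.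
    by rewrite divr_ge0// ltW.
  rewrite /D le_eqVlt; apply/orP; left; apply/eqP.
  by field; rewrite !gt_eqF// powR_gt0.
have := bounded_by_wmeas C0 fC (ltr0Sn R 3) x4 s0; rewrite sp.
apply/negP; rewrite -ltNge.
apply: (@lt_le_trans _ _ (\sum_(i <- idx)
    wmeas w (superlevel (f (e (a i))) (c i.1)))%E); last first.
  apply: sum_wmeas_le => // [i si t|i j _ _ ij]; rewrite /superlevel/=.
    move=> ct; have fi0 : f (e (a i)) t != 0.
      by rewrite -normr_gt0 (lt_trans _ ct).
    have -> : f x t = u i * f (e (a i)) t.
      rewrite /x linear_sum weak_lp_sumE (bigD1_seq i)//= big1 ?addr0.
        by rewrite linearZZ.
      move=> j ji; rewrite linearZZ -[LHS]/(u j * f (e (a j)) t).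
      have [_ /(_ t)[->|fi]] := aD _ _ ji; first by rewrite mulr0.
      by rewrite fi eqxx in fi0.
    by rewrite normrM gtr0_norm// /u mulrAC ltr_pdivlMr// ltr_pM2l.
  apply/seteqP; split=> // t [/= ti tj].
  have [_ /(_ t)[fi|fj]] := aD _ _ ij.
    by move: ti; rewrite fi normr0 ltNge ltW.
  by move: tj; rewrite fj normr0 ltNge ltW.
apply: (@lt_le_trans _ _ (\sum_(i <- idx) th * om i.1 / d i.1)%:E); last first.
  rewrite -sumEFin; apply: lee_sum => i _.
  by have [_ _ /(_ _ (aA i))[]] := prof i.1.
rewrite lte_fin (sum_idx xpredT (fun k => th * om k / d k)).
apply: (@lt_le_trans _ _ (\sum_(0 <= k < K) th / sg)).
  rewrite big_const_nat subn0 iter_addr_0 -[ltRHS]mulr_natr [ltRHS]mulrAC.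
  by rewrite ltr_pM2r ?invr_gt0// mulrC.
apply: ler_sum => k _; rewrite -[leLHS](_ : y k * (th * om k / d k) = _).
  by rewrite ler_wpM2r// divr_ge0 ?mulr_ge0 ?ltW.
by rewrite /y; field; rewrite !gt_eqF.
Qed.

End scales.

(** * Obstruction to embeddings into a direct sum *)

Section obstruction.
Context {R : realType} {p : R} (p1 : 1 < p) {S T T' : choiceType}.
Context (v : S -> {posnum R}) (w : T -> {posnum R}) (w' : T' -> {posnum R}).
Local Notation V := (weak_lp p1 v).
Local Notation Z := (weak_lp p1 w).
Local Notation W := (weak_lp p1 w').
Local Notation e := (wlp_unit p1 v).

Let p0 : 0 < p. Proof. exact: lt_trans p1. Qed.

Context (f1 : {linear V -> Z}) (f2 : {linear V -> W}) (C C' B : R).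
Hypotheses (C0 : 0 < C) (f1C : bounded_by f1 C).
Hypotheses (C'0 : 0 < C') (f2C : bounded_by f2 C').
Hypotheses (B0 : 0 < B)
  (fB : forall x r, 0 < r -> (weak_lp_norm (f1 x) <= r%:E)%E ->
    (weak_lp_norm (f2 x) <= r%:E)%E -> (weak_lp_norm x <= (B * r)%:E)%E).

(** Since [f2] vanishes at the unit vector, the lower bound passes to [f1], and
    it is attained at some level [c]. The superlevel set of the image at [c] is
    nonempty and carried by atoms of weight at least [M * om], while its measure
    is at most [C ^ p * om / c ^ p]; this bounds [c]. A rational [q] in
    [(c / 2, c)] serves as well as [c] up to the factor [2 ^ p]. *)
Lemma unit_image_level (M om : R) (a : S) : 0 < M -> (v a)%:num = om ->
  (forall t, (w t)%:num < M * om -> f1 (e a) t = 0) ->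
  (forall t, f2 (e a) t = 0) ->
  exists q : rat, [/\ 0 < (ratr q : R), (ratr q : R) `^ p <= C `^ p / M &
    (((4 * B)^-1 `^ p * om / ratr q `^ p)%:E <=
      wmeas w (superlevel (f1 (e a)) (ratr q)))%E].
Proof.
move=> M0 va wf1 f20; have om0 : 0 < om by rewrite -va gt0.
pose r := om `^ p^-1 / (2 * B).
have r0 : 0 < r by rewrite divr_gt0 ?powR_gt0 ?mulr_gt0.
have : ~ (weak_lp_norm (f1 (e a)) <= r%:E)%E.
  move=> /(fB r0)-/(_ _)/wrap[].
    rewrite (_ : f2 (e a) = 0) ?weak_lp_norm0 ?lee_fin ?ltW//.
    by apply: val_inj; apply/funext => t; rewrite /= f20.
  have -> : B * r = (v a)%:num `^ p^-1 / 2 by rewrite va /r; field; rewrite gt_eqF.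
  exact: wlp_norm_unit_gt.
move=> /(wlp_norm_leP p1 _ _ (ltW r0))/existsNP[c /not_implyP[c0 /negP]].
rewrite -ltNge powR_div ?(ltW r0)// => rc.
have eom b : 0 < b -> (wmeas v (superlevel (e a) b) <= (om / b `^ p)%:E)%E.
  move=> b0; have /(wlp_norm_leP p1 _ _ (powR_ge0 _ _))/(_ _ b0) := wlp_norm_unit p1 v a.
  by rewrite powR_div ?powR_ge0// powRVK// va.
have cM : c `^ p <= C `^ p / M.
  have [t ft] : superlevel (f1 (e a)) c !=set0.
    apply/set0P; apply: contraTneq rc => ->.
    by rewrite /wmeas esum_set0 -leNgt lee_fin divr_ge0 ?powR_ge0.
  have wt : M * om <= (w t)%:num.
    rewrite leNgt; apply/negP => /wf1 ft0.
    by move: ft; rewrite /superlevel/= ft0 normr0 ltNge ltW.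
  have := le_trans (wmeas_ge w ft) (bounded_by_wmeas C0 f1C om0 eom c0).
  rewrite lee_fin => /(le_trans wt).
  rewrite ler_pdivlMr ?powR_gt0// mulrAC ler_pM2r// => cM.
  by rewrite ler_pdivlMr// mulrC.
have [q] : exists q : rat, (ratr q : R) \in `]c / 2, c[.
  by apply: rat_in_itvoo; rewrite ltr_pdivrMr// ltr_pMr// ltr1n.
rewrite in_itv/= => /andP[cq qc].
have q0 : 0 < (ratr q : R) by apply: lt_trans cq; rewrite divr_gt0.
exists q; split=> //.
  by apply: le_trans cM; apply: ge0_ler_powR; rewrite ?nnegrE ?ltW.
apply: (@le_trans _ _ (wmeas w (superlevel (f1 (e a)) c))); last first.
  by apply: le_wmeas => t; exact: lt_trans.
apply: le_trans (ltW rc); rewrite lee_fin.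
have -> : (4 * B)^-1 `^ p * om = (r / 2) `^ p.
  rewrite -[om](@powRVK _ p)// ?(ltW om0)// -powRM ?powR_ge0//; last first.
    by rewrite invr_ge0 mulr_ge0// ltW.
  by congr (_ `^ p); rewrite /r; field; rewrite gt_eqF.
have r20 : 0 <= r / 2 by rewrite mulr_ge0// ltW.
rewrite -!powR_div ?(ltW r0)//.
apply: ge0_ler_powR; rewrite ?nnegrE ?(ltW p0) ?(divr_ge0 r20 (ltW q0))//.
  exact: divr_ge0 (ltW r0) (ltW c0).
rewrite -mulrA ler_pM2l// -invfM lef_pV2 ?posrE ?(mulr_gt0 (ltr0Sn R 1) q0)//.
by rewrite mulrC -ler_pdivrMr// ltW.
Qed.

(** For each [M], removing from [A] the atoms whose image meets the light
    coordinates or the second summand leaves uncountably many, and one rational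
    level suits uncountably many of these. *)
Lemma no_bounded_embedding :
  ~ (forall M, 0 < M -> exists om A, [/\ 0 < om, ~ countable A,
      forall a, A a -> (v a)%:num = om,
      smaller [set t | (w t)%:num < M * om] A & smaller [set: T'] A]).
Proof.
move=> H; apply: (no_vanishing_common_levels C0 f1C (th := (4 * B)^-1 `^ p)).
  by rewrite powR_gt0// invr_gt0 mulr_gt0.
move=> eps eps0; pose M := C `^ p / eps `^ p.
have M0 : 0 < M by rewrite divr_gt0 ?powR_gt0.
have [om [A [om0 Anc vA DA T'A]]] := H M M0.
pose bad := (\bigcup_(t in [set t | (w t)%:num < M * om])
    [set a | (v a)%:num = om /\ f1 (e a) t != 0]) `|`
  (\bigcup_(t in [set: T']) [set a | (v a)%:num = om /\ f2 (e a) t != 0]).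
have badA : smaller bad A.
  apply: smallerU => //; apply: smaller_bigcup => // t _.
    exact: (countable_image_neq0 C0 f1C).
  exact: (countable_image_neq0 C'0 f2C).
have := smaller_setD_uncountable Anc badA.
pose P (q : rat) (a : S) := [/\ A a, 0 < (ratr q : R), (ratr q : R) `^ p <= C `^ p / M &
    (((4 * B)^-1 `^ p * om / ratr q `^ p)%:E <=
      wmeas w (superlevel (f1 (e a)) (ratr q)))%E].
have sub : A `\` bad `<=` \bigcup_(q in [set: rat]) P q.
  move=> a [Aa na]; have va := vA _ Aa.
  have [t wt|t|q [q0 qM qP]] := unit_image_level M0 va; last by exists q.
  - by apply/eqP; apply: contrapT => /negP fa; apply: na; left; exists t.
  - by apply/eqP; apply: contrapT => /negP fa; apply: na; right; exists t.
move=> nc; have [q ncq] : exists q, ~ countable (P q).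
  apply: contrapT => /forallNP Pc; apply: nc.
  apply: sub_countable (subset_card_le sub) _; apply: bigcup_countable => // q _.
  exact: contrapT (Pc q).
have [a [_ q0 qM _]] : P q !=set0.
  by apply/set0P; apply/eqP => P0; apply: ncq; rewrite P0.
exists (ratr q), om, (P q); split.
  rewrite q0 /=; move: qM; rewrite /M invf_div mulrCA mulfV ?mulr1 ?gt_eqF ?powR_gt0//.
  rewrite leNgt => /negP qe; rewrite leNgt; apply/negP => eq; apply: qe.
  by apply: gt0_ltr_powR; rewrite ?nnegrE ?ltW.
by split=> // b [Ab _ _ qb]; split; first exact: vA.
Qed.

End obstruction.

(** * Continuous embeddings *)

Section embeddings.
Context {R : realType}.

(** [X] is isomorphic to a subspace of [Y]; a continuous left inverse [g] defined
    on all of [Y], not necessarily linear, expresses that the inverse of [f] is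
    continuous, and both isomorphisms and inclusions of summands supply one. *)
Definition embeds (X Y : topologicalLmodType R) : Prop :=
  exists (f : {linear X -> Y}) (g : Y -> X),
    [/\ cancel f g, continuous f & continuous g].

Lemma embeds_refl (X : topologicalLmodType R) : embeds X X.
Proof. by exists idfun, idfun; split=> // x. Qed.

Lemma embeds_trans (X Y Z : topologicalLmodType R) :
  embeds X Y -> embeds Y Z -> embeds X Z.
Proof.
move=> [f [g [fgK cf cg]]] [f' [g' [fgK' cf' cg']]].
exists (f' \o f : {linear X -> Z}), (g \o g'); split.
- by move=> x; rewrite /= fgK' fgK.
- by move=> x; apply: continuous_comp; [exact: cf|exact: cf'].
- by move=> x; apply: continuous_comp; [exact: cg'|exact: cg].
Qed.

Lemma isomorphic_embeds (X Y : topologicalLmodType R) :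
  isomorphic X Y -> embeds X Y /\ embeds Y X.
Proof.
move=> [f [g [fgK gfK cf cg]]]; split; first by exists f, g.
have glin : linear g.
  by move=> a x y; apply: (can_inj fgK); rewrite linearP !gfK.
pose G : {linear Y -> X} := HB.pack g (GRing.isLinear.Build R Y X _ g glin).
by exists G, f.
Qed.

Context (X Y : topologicalLmodType R).

Lemma direct_sum_fst_continuous : continuous (fun z : direct_sum X Y => z.1).
Proof. by move=> z U zU; exists (U, setT) => [|u []//]; split=> //; exact: filterT. Qed.

Lemma direct_sum_snd_continuous : continuous (fun z : direct_sum X Y => z.2).
Proof. by move=> z U zU; exists (setT, U) => [|u []//]; split=> //; exact: filterT. Qed.

Lemma embeds_inl : embeds X (direct_sum X Y).
Proof.
pose i (x : X) : direct_sum X Y := (x, 0).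
have ilin : linear i.
  move=> a x y; rewrite -[RHS]/(a *: x + y, a *: 0 + 0 : Y).
  by rewrite scaler0 addr0.
pose I : {linear X -> direct_sum X Y} := HB.pack i (GRing.isLinear.Build R X _ _ i ilin).
exists I, (fun z => z.1); split=> //; last exact: direct_sum_fst_continuous.
move=> x U [[A B] [/= xA B0] AB]; apply: filterS xA => y Ay; apply: AB.
by split=> //=; exact: nbhs_singleton.
Qed.

Lemma embeds_inr : embeds Y (direct_sum X Y).
Proof.
pose i (y : Y) : direct_sum X Y := (0, y).
have ilin : linear i.
  move=> a x y; rewrite -[RHS]/(a *: 0 + 0 : X, a *: x + y).
  by rewrite scaler0 addr0.
pose I : {linear Y -> direct_sum X Y} := HB.pack i (GRing.isLinear.Build R Y _ _ i ilin).
exists I, (fun z => z.2); split=> //; last exact: direct_sum_snd_continuous.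
move=> x U [[A B] [/= A0 xB] AB]; apply: filterS xB => y By; apply: AB.
by split=> //=; exact: nbhs_singleton.
Qed.

End embeddings.

Section scaling.
Context {R : realType} {p : R} (p1 : 1 < p) {S : choiceType}.
Context (v : S -> {posnum R}).
Local Notation V := (weak_lp p1 v).

Lemma nbhs0_weak_lp (U : set V) : nbhs (0 : V) U <->
  exists2 r : R, 0 < r & forall x : V, (weak_lp_norm x < r%:E)%E -> U x.
Proof.
split=> [/weak_lp_nbhsP|] [r r0 rU].
  by exists r => // x xr; apply: rU; rewrite sub0r weak_lp_normN.
apply/weak_lp_nbhsP; exists r => // x; rewrite sub0r weak_lp_normN; exact: rU.
Qed.

Lemma weak_lp_normZ_lt (x : V) (r s : R) : 0 < r -> 0 < s ->
  (weak_lp_norm x <= r%:E)%E -> (weak_lp_norm ((s / (2 * r)) *: x) < s%:E)%E.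
Proof.
move=> r0 s0 xr; have s2r : 0 < s / (2 * r) by rewrite divr_gt0// mulr_gt0.
apply: le_lt_trans (weak_lp_normZ _ _) _.
apply: (@le_lt_trans _ _ ((s / (2 * r))%:E * r%:E)%E).
  by rewrite gtr0_norm// lee_pmul2l.
rewrite -EFinM lte_fin (_ : s / (2 * r) * r = s / 2); last by field; rewrite gt_eqF.
by rewrite ltr_pdivrMr// ltr_pMr// ltr1n.
Qed.

Lemma weak_lp_normZ_le (x : V) (r s : R) : 0 < r -> 0 < s ->
  (weak_lp_norm ((s / (2 * r)) *: x) <= 1)%E ->
  (weak_lp_norm x <= (2 / s * r)%:E)%E.
Proof.
move=> r0 s0 xr; have s2r : 0 < s / (2 * r) by rewrite divr_gt0// mulr_gt0.
rewrite -[x](scalerK (lt0r_neq0 s2r)); apply: le_trans (weak_lp_normZ _ _) _.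
rewrite gtr0_norm ?invr_gt0//.
apply: (@le_trans _ _ ((s / (2 * r))^-1%:E * 1)%E).
  by apply: lee_wpmul2l => //; rewrite lee_fin invr_ge0 ltW.
by rewrite mule1 lee_fin invf_div le_eqVlt; apply/orP; left; apply/eqP; ring.
Qed.

End scaling.


Lemma continuous_bounded_by {R : realType} {p : R} (p1 : 1 < p) {S T : choiceType}
    (v : S -> {posnum R}) (w : T -> {posnum R})
    (f : {linear weak_lp p1 v -> weak_lp p1 w}) : continuous f ->
  exists2 C, 0 < C & bounded_by f C.
Proof.
move=> cf; have : nbhs (0 : weak_lp p1 v) (f @^-1` [set z | (weak_lp_norm z < 1)%E]).
  apply: cf; rewrite linear0; apply/nbhs0_weak_lp; by exists 1.
move=> /nbhs0_weak_lp[s s0 sf]; exists (2 / s); first by rewrite divr_gt0.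
move=> x r r0 xr; apply: weak_lp_normZ_le => //.
rewrite -linearZZ; apply: ltW; apply: sf; exact: weak_lp_normZ_lt.
Qed.

Section bounded_embeddings.
Context {R : realType} {p : R} (p1 : 1 < p) {S T T' : choiceType}.
Context (v : S -> {posnum R}) (w : T -> {posnum R}) (w' : T' -> {posnum R}).
Local Notation V := (weak_lp p1 v).
Local Notation Z := (weak_lp p1 w).
Local Notation W := (weak_lp p1 w').

Lemma no_embeds_direct_sum :
  (forall M : R, 0 < M -> exists om A, [/\ 0 < om, ~ countable A,
      forall a, A a -> (v a)%:num = om,
      smaller [set t | (w t)%:num < M * om] A & smaller [set: T'] A]) ->
  ~ embeds V (direct_sum Z W).
Proof.
move=> H [f [g [fgK cf cg]]].
have lin1 : linear (fun x => (f x).1 : Z) by move=> a x y; rewrite linearP.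
have lin2 : linear (fun x => (f x).2 : W) by move=> a x y; rewrite linearP.
pose f1 : {linear V -> Z} := HB.pack (fun x => (f x).1 : Z)
  (GRing.isLinear.Build R V Z _ _ lin1).
pose f2 : {linear V -> W} := HB.pack (fun x => (f x).2 : W)
  (GRing.isLinear.Build R V W _ _ lin2).
have [|C1 C10 f1C] := continuous_bounded_by (f := f1).
  by move=> x; apply: (continuous_comp (cf x)); exact: direct_sum_fst_continuous.
have [|C2 C20 f2C] := continuous_bounded_by (f := f2).
  by move=> x; apply: (continuous_comp (cf x)); exact: direct_sum_snd_continuous.
have g0 : g 0 = 0 by rewrite -(linear0 f) fgK.
have [[A B] /= [A0 B0] AB] :
    nbhs (0 : direct_sum Z W) (g @^-1` [set x : V | (weak_lp_norm x < 1)%E]).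
  by apply: cg; rewrite g0; apply/nbhs0_weak_lp; exists 1.
have /nbhs0_weak_lp[a a0 aA] := A0; have /nbhs0_weak_lp[b b0 bB] := B0.
pose s := Num.min a b; have s0 : 0 < s by rewrite lt_min a0 b0.
have sa : s <= a by rewrite ge_min lexx.
have sb : s <= b by rewrite ge_min lexx orbT.
apply: (no_bounded_embedding C10 f1C C20 f2C (divr_gt0 (ltr0Sn R 1) s0) _ H).
move=> x r r0 x1 x2; apply: weak_lp_normZ_le => //; apply: ltW.
rewrite -[X in weak_lp_norm X]fgK; apply: (AB (f _)).
rewrite linearZZ; split.
  by apply: aA; apply: lt_le_trans (weak_lp_normZ_lt r0 s0 x1) _; rewrite lee_fin.
by apply: bB; apply: lt_le_trans (weak_lp_normZ_lt r0 s0 x2) _; rewrite lee_fin.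
Qed.

End bounded_embeddings.

(** * The five classes *)

Section classes.
Local Open Scope card_scope.
Context {R : realType} {p : R} (p1 : 1 < p).

Lemma smaller_setX_nat {P T : Type} (B : set T) : ~ countable B ->
  smaller [set: P] B -> smaller [set: P * nat] B.
Proof.
move=> ncB PB.
have : smaller (\bigcup_(x in [set: P]) [set z : P * nat | z.1 = x]) B.
  apply: smaller_bigcup => // x _.
  by apply: sub_countable (countableP [set: nat]); apply/card_le_relP;
    exists (fun z n => z.2 = n) => [[y n] _|[y n] [y' n'] _ /= -> -> -> <-];
    first exists n.
by apply: smaller_le; apply: subset_card_le => z _; exists z.1.
Qed.

(** The atoms of [F(Q)] of index [n] have weight [2 ^- n.+1], so for large [n] no
    atom of the target is light compared to them. *)
Lemma F_not_embeds {Q P T : choiceType} (w : T -> {posnum R}) :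
  (forall t, 1 <= (w t)%:num) -> ~ countable [set: Q] ->
  smaller [set: P] [set: Q] ->
  ~ embeds (F_space p1 Q) (direct_sum (weak_lp p1 w) (F_space p1 P)).
Proof.
move=> w1 Qnc PQ; apply: no_embeds_direct_sum => M M0.
pose n := Num.bound M; exists (2 ^- n.+1), [set z : Q * nat | z.2 = n].
have Qn : [set: Q] #<= [set z : Q * nat | z.2 = n].
  by apply/card_le_relP; exists (fun q z => z = (q, n)) => [q _|q q' z _ _ -> []//];
    exists (q, n).
have nc : ~ countable [set z : Q * nat | z.2 = n].
  by move=> c; apply: Qnc; exact: sub_countable c.
split=> //.
- by move=> z /= ->.
- rewrite (_ : [set _ | _] = set0); first exact: smaller_countable.
  apply/seteqP; split=> // t /=; apply/negP; rewrite -leNgt.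
  apply: le_trans (w1 t); rewrite ler_pdivrMr ?exprn_gt0// mul1r.
  apply: (@le_trans _ _ n%:R); first by rewrite ltW// archi_boundP// ltW.
  by rewrite -natrX ler_nat (leq_trans (ltnW (ltn_expl n (ltnSn 1))))// leq_exp2l.
- apply: smaller_setX_nat => // QP; apply: PQ; exact: card_le_trans Qn QP.
Qed.

(** The atoms of [E(Pi)] of weight below [M] lie in finitely many [Pi n], whose
    union is smaller than [G]. *)
Lemma ell_not_embeds {G U P : choiceType} (Pi : nat -> set U) :
  ~ countable [set: G] -> (forall n, smaller (Pi n) [set: G]) ->
  smaller [set: P] [set: G] ->
  ~ embeds (ell_space p1 G) (direct_sum (E_space p1 Pi) (F_space p1 P)).
Proof.
move=> Gnc PiG PG; apply: no_embeds_direct_sum => M M0.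
exists 1, [set: G]; split=> //; last exact: smaller_setX_nat.
pose k := Num.bound M.
have : smaller [set u | exists2 n, (n < k)%N & Pi n u] [set: G].
  elim: k => [|k IH].
    rewrite (_ : [set _ | _] = set0); first exact: smaller_countable.
    by apply/seteqP; split=> // u [].
  apply: smaller_le (smallerU Gnc IH (PiG k)); apply: subset_card_le => u [n].
  by rewrite ltnS leq_eqVlt => /orP[/eqP->|nk] Pu; [right|left; exists n].
apply: smaller_le; apply/card_le_relP; exists (fun t u => u = val t); last first.
  by move=> t t' u _ _ -> /val_inj.
move=> t; rewrite /= mulr1 => tM; exists (val t) => //.
have [n _ Pn] := set_valP t.
have Pxget : [set n | Pi n (val t)] (xget 0%N [set n | Pi n (val t)]).
  by apply: xgetPex; exists n.
exists (xget 0%N [set n | Pi n (val t)]) => //.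
have := lt_trans tM (archi_boundP (ltW M0)).
by rewrite -natrX ltr_nat; apply: ltn_trans; exact: ltn_expl.
Qed.

Lemma admissible_smaller {G U : Type} (Pi : nat -> set U) :
  admissible G Pi -> forall n, smaller (Pi n) [set: G].
Proof. by case=> _ _ _ PiG n; have [] := PiG n. Qed.

Lemma intermediate_smaller {P G : Type} : intermediate P G ->
  smaller [set: P] [set: G].
Proof. by case=> _ []. Qed.

Lemma intermediate_uncountable {P G : Type} : intermediate P G ->
  ~ countable [set: P].
Proof. by case=> -[_ nP] _. Qed.

Lemma E_weight_ge1 {U : choiceType} (Pi : nat -> set U) (t : \bigcup_n Pi n) :
  1 <= (@E_weight R U Pi t)%:num.
Proof. by rewrite /= exprn_ege1// ler1n. Qed.

Context (G : choiceType) (Gnc : ~ countable [set: G]).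

Lemma space_of_type_atoms_ge1 i X : space_of_type p1 G i X -> (i < 3)%N ->
  exists (T : choiceType) (w : T -> {posnum R}),
    (forall t, 1 <= (w t)%:num) /\ X = weak_lp p1 w.
Proof.
case=> // [_|U Pi _ _]; first by exists G, (fun=> 1%:pos).
by exists _, (@E_weight R U Pi); split=> //; exact: E_weight_ge1.
Qed.

Lemma space_of_type_F_embeds j Y : space_of_type p1 G j Y -> (2 < j)%N ->
  exists Q : choiceType, ~ countable [set: Q] /\ embeds (F_space p1 Q) Y.
Proof.
case=> // [_|P PG _|U Pi P _ PG _].
- by exists G; split=> //; exact: embeds_refl.
- exists P; split; [exact: intermediate_uncountable PG|exact: embeds_inr].
- exists P; split; [exact: intermediate_uncountable PG|exact: embeds_inr].
Qed.

(** Types 1 and 2 are ruled out as hosts of [F(Q)]; otherwise [i] and [j] are both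
    at most 2 or both at least 3, and [X] does not embed into [Y]. *)
Lemma space_of_type_not_embeds i j X Y : (i < j)%N ->
  space_of_type p1 G i X -> space_of_type p1 G j Y ->
  embeds X Y -> embeds Y X -> False.
Proof.
move=> ij Xi Yj XY YX.
have void_small (Q : choiceType) : ~ countable [set: Q] ->
    smaller [set: void] [set: Q].
  by move=> Qnc; apply: smaller_countable => //; exact: countableP.
have [i3|i3] := ltnP i 3; have [j3|j3] := ltnP 2 j.
- have [Q [Qnc QY]] := space_of_type_F_embeds Yj j3.
  have [T [w [w1 XE]]] := space_of_type_atoms_ge1 Xi i3.
  apply: (F_not_embeds w1 Qnc (void_small _ Qnc)); rewrite XE in YX.
  exact: embeds_trans (embeds_trans QY YX) (embeds_inl _ _).
- case: Xi ij i3 XY YX => //; case: Yj j3 => // U Pi PiG _ _ _ XY _.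
  apply: (ell_not_embeds Gnc (admissible_smaller PiG) (void_small _ Gnc)).
  exact: embeds_trans XY (embeds_inl _ _).
- case: Xi ij i3 XY YX => // [|P PG|U Pi P _ _]; case: Yj j3 => //.
  + move=> P PG _ _ _ XY _.
    by apply: F_not_embeds (intermediate_smaller PG) XY.
  + move=> U Pi P PiG PG _ _ _ XY _.
    by apply: F_not_embeds (intermediate_smaller PG) XY => // t; exact: E_weight_ge1.
  + move=> U Pi P' PiG P'G _ _ _ XY _.
    apply: (ell_not_embeds Gnc (admissible_smaller PiG) (intermediate_smaller P'G)).
    exact: embeds_trans (embeds_inl _ _) XY.
- by have := leq_ltn_trans i3 (leq_trans ij j3).
Qed.

End classes.

Theorem theorem19 (R : realType) (p : R) (p1 : 1 < p) (G : choiceType)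
    (G_uncountable : ~ countable [set: G])
    (i j : nat) (ij : i <> j) (X Y : topologicalLmodType R) :
  space_of_type p1 G i X -> space_of_type p1 G j Y -> ~ isomorphic X Y.
Proof.
move=> Xi Yj /isomorphic_embeds[XY YX].
have [ij'|ji|//] := ltngtP i j.
  exact (space_of_type_not_embeds G_uncountable ij' Xi Yj XY YX).
exact (space_of_type_not_embeds G_uncountable ji Yj Xi YX XY).
Qed.
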